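(* Let $H$ be a real Hilbert space and $\Psi=F+R$, where $R:H\to\mathbb{R}\cup\{\pm\infty\}$ is proper, convex and lower semicontinuous; $F:H\to\mathbb{R}$ is continuously Fréchet differentiable on $\operatorname{int}(\operatorname{dom}F)\supseteq\operatorname{dom}R$; and $\nabla F:H\to H$ is globally $L$-Lipschitz continuous ($L>0$). Suppose that $\Psi$ is bounded from below. Let $\{u_k\}_k\subset H$ be generated, with step-sizes $\{\alpha_k\}_k\subset\mathbb{R}_{>0}$, by the nonmonotone splitting algorithm described in the context. Put $\bar\alpha:=\max\{\frac{\eta L}{2(1-\delta)},\alpha_{\sup}\}$ and $C_G:=\frac{3\bar\alpha+L}{\alpha_{\inf}}$. Then: (i) Either the algorithm terminates after finitely many iterations with a stationary point (an element of $S_*$), or $\lim_{k\to\infty}\|G_{\alpha_k}(u_k)\|=0$. (ii) For every $k\ge 1$, $$\min_{0\le i\le k}\|G_{\alpha_{\inf}}(u_i)\|\le C_G^{\,m_{\max}}\sqrt{\frac{\bar\alpha\,(m_{\max}+1)\,(\Psi(u_0)-\Psi(u_k))}{k\,\delta}}.$$ (iii) If, in addition, $\nabla F:\operatorname{int}(\operatorname{dom}F)\to H$ is weak-to-strong sequentially continuous, then every weak sequential accumulation point of $\{u_k\}_k$ belongs to $S_*$.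
   Context: For $u\in\operatorname{int}(\operatorname{dom}F)$, $\nabla F(u)\in H$ is the Riesz representative of the derivative $F'(u)$. $\partial R$ is the convex subdifferential. The set of stationary points is $S_*:=\{u\in H:-\nabla F(u)\in\partial R(u)\}$. For $\alpha>0$: $\operatorname{Prox}_{\frac1\alpha R}(u):=\operatorname{argmin}_{v\in H}\big(R(v)+\frac{\alpha}{2}\|v-u\|^2\big)$, $T_\alpha(u):=\operatorname{Prox}_{\frac1\alpha R}\big(u-\frac1\alpha\nabla F(u)\big)$, and $G_\alpha(u):=\alpha(u-T_\alpha(u))$ (gradient mapping). Nonmonotone splitting algorithm. Parameters: $0<\delta<1$, $m_{\max}\in\mathbb{N}_0$, $\eta>1$, $\alpha_{\sup}>\alpha_{\inf}>0$, $u_0\in H$, $\alpha_0>0$. Memory: $m(0)=0$, $m(k)=\min\{m(k-1)+1,m_{\max}\}$ for $k\ge1$. For $k=0,1,2,\dots$: stop if $G_\alpha(u_k)=0$ for some (equivalently every) $\alpha>0$; otherwise compute a Barzilai–Borwein value $\alpha_k^{BB}$, set $\alpha_{\mathrm{int},k}:=\max\{\alpha_{\inf},\min\{\alpha_{\sup},\alpha_k^{BB}\}\}$ and $\alpha_k:=\alpha_{\mathrm{int},k}\,\eta^{i_k}$, where $i_k\in\mathbb{N}_0$ is the smallest integer such that, with $u_{k+1}:=T_{\alpha_k}(u_k)=u_k-\frac{1}{\alpha_k}G_{\alpha_k}(u_k)$, $$\Psi(u_{k+1})\le\max_{0\le j\le m(k)}\Psi(u_{k-j})-\frac{\delta}{\alpha_k}\|G_{\alpha_k}(u_k)\|^2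 .$$ Barzilai–Borwein values: $\alpha_0^{BB}:=\alpha_0$; for $k\ge1$, with $s=u_k-u_{k-1}$, $y=\nabla F(u_k)-\nabla F(u_{k-1})$, $z=G_{\alpha_{k-1}}(u_k)-G_{\alpha_{k-1}}(u_{k-1})$, the value $\alpha_k^{BB}$ is one of $\frac{(s,y)}{(s,s)},\ \frac{(y,y)}{(s,y)},\ \frac{(s,z)}{(s,s)},\ \frac{(z,z)}{(s,z)}$, or alternates between the first two, or between the last two (first of the pair for even $k$, second for odd $k$); if a denominator is zero any real value may be used. Assertions for all $k$ and about limits refer to the case in which the algorithm does not stop, so that $\{u_k\}_k$ is an infinite sequence. *)

(* Defs.v *)
From HB Require Import structures.
From mathcomp Require Import all_boot all_order all_algebra.
From mathcomp Require Import sesquilinear.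
From mathcomp Require Import all_classical all_reals all_analysis.

Set Implicit Arguments.
Unset Strict Implicit.
Unset Printing Implicit Defensive.
Import Order.TTheory GRing.Theory Num.Theory.
Import numFieldNormedType.Exports.

Local Open Scope classical_set_scope.
Local Open Scope ring_scope.

Section ExtendedRealFunctions.
Context {K : realType} {H : completeNormedModType K}.
Implicit Types (f : H -> \bar K) (u v w : H).

Definition edom f : set H := [set u | (f u < +oo)%E].

Definition proper_ereal f : Prop :=
  (forall u, (-oo < f u)%E) /\ edom f !=set0.

(* Since 0 * +oo = 0 in \bar K, the inequality also holds trivially at the
   endpoints t = 0 and t = 1. *)
Definition convex_ereal f : Prop :=
  forall (u v : H) (t : K), 0 <= t -> t <= 1 ->
    (f (t *: u + (1 - t) *: v)%R <= t%:E * f u + (1 - t)%:E * f v)%E.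

Definition argmin_set f : set H := [set v | forall w, (f v <= f w)%E].

(* The second clause is the continuity, on the open set D, of u |-> 'd g u for
   the operator norm. *)
Definition continuously_differentiable_on (D : set H) (g : H -> K) : Prop :=
  (forall u, D u -> differentiable g u) /\
  (forall u, D u -> forall e : K, 0 < e ->
     \forall v \near u, forall h : H, `|'d g v h - 'd g u h| <= e * `|h|).

End ExtendedRealFunctions.

Section Hilbert.
Context {K : realType} {H : completeNormedModType K} (dot : {dot H for idfun}).
Implicit Types (u v w : H).

(* A complete normed space whose norm comes from the inner product. *)
Definition is_hilbert : Prop := forall u, dot u u = `|u| ^+ 2.

(* gradF u is the Riesz representative of the derivative at u. Outside the
   interior of the domain of F the values of gradF are left free here. *)
Definition is_gradient (F : H -> \bar K) (gradF : H -> H) : Prop :=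
  forall u, (edom F)° u ->
    forall h : H, 'd (fine \o F) u h = dot (gradF u) h.

Definition subdifferential (R : H -> \bar K) (u : H) : set H :=
  [set g | R u \is a fin_num /\
           forall v, (R u + (dot g (v - u))%:E <= R v)%E].

Definition weak_cvg (v : nat -> H) (w : H) : Prop :=
  forall h : H, (fun n => dot (v n) h) @ \oo --> dot w h.

Definition weak_seq_accumulation_point (v : nat -> H) (w : H) : Prop :=
  exists2 phi : nat -> nat,
    {homo phi : m n / (m < n)%N} & weak_cvg (v \o phi) w.

Definition weak_to_strong_seq_continuous (D : set H) (T : H -> H) : Prop :=
  forall (v : nat -> H) (w : H),
    (forall n, D (v n)) -> D w -> weak_cvg v w -> T \o v @ \oo --> T w.

End Hilbert.

Section ProximalGradient.
Context {K : realType} {H : completeNormedModType K} (dot : {dot H for idfun}).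
Variables (F R : H -> \bar K) (gradF : H -> H).

Definition objective (u : H) : \bar K := (F u + R u)%E.

Definition stationary : set H :=
  [set u | subdifferential dot R u (- gradF u)].

(* The argmin is a singleton when R is proper, convex and lower semicontinuous
   and a > 0; xget picks its element (and 0 if the argmin were empty). *)
Definition prox (a : K) (u : H) : H :=
  xget 0 (argmin_set (fun v => (R v + (a / 2 * `|v - u| ^+ 2)%:E)%E)).

Definition prox_grad (a : K) (u : H) : H := prox a (u - a^-1 *: gradF u).

Definition grad_map (a : K) (u : H) : H := a *: (u - prox_grad a u).

Definition stop_test (u : H) : Prop := exists2 a : K, 0 < a & grad_map a u = 0.

Variables (delta eta alpha_inf alpha_sup : K) (m_max : nat).

Fixpoint memory (k : nat) : nat :=
  if k is k'.+1 then minn (memory k').+1 m_max else 0%N.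

(* The Barzilai-Borwein value a is num / den, and any real if den = 0. *)
Definition bb_quotient (num den a : K) : Prop := den != 0 -> a = num / den.

(* The rule may change with k, so that the two alternating rules are covered as
   well as the four fixed ones. *)
Definition bb_value (u : nat -> H) (alpha : nat -> K) (k : nat) (a : K) : Prop :=
  let s := u k - u k.-1 in
  let y := gradF (u k) - gradF (u k.-1) in
  let z := grad_map (alpha k.-1) (u k) - grad_map (alpha k.-1) (u k.-1) in
  [\/ bb_quotient (dot s y) (dot s s) a,
      bb_quotient (dot y y) (dot s y) a,
      bb_quotient (dot s z) (dot s s) a |
      bb_quotient (dot z z) (dot s z) a].

(* The maximum is +oo as long as the window contains an iterate outside the
   domain of the objective (only u 0 can be one); the test then succeeds. *)
Definition sufficient_decrease (u : nat -> H) (k : nat) (a : K) : Prop :=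
  (objective (prox_grad a (u k)) <=
     \big[maxe/-oo]_(j < (memory k).+1) objective (u (k - j)%N)
     - (delta / a * `|grad_map a (u k)| ^+ 2)%:E)%E.

Definition algorithm_step (alpha0 : K) (u : nat -> H) (alpha : nat -> K)
    (k : nat) : Prop :=
  exists (alphaBB : K) (i : nat),
    let alpha_int := Num.max alpha_inf (Num.min alpha_sup alphaBB) in
    [/\ (if k == 0%N then alphaBB = alpha0 else bb_value u alpha k alphaBB),
        alpha k = alpha_int * eta ^+ i,
        sufficient_decrease u k (alpha k),
        (forall i', (i' < i)%N ->
           ~ sufficient_decrease u k (alpha_int * eta ^+ i')) &
        u k.+1 = prox_grad (alpha k) (u k)].

(* If the algorithm stops at the iterate u N, then the values u k and alpha k'
   with k > N and k' >= N are arbitrary. *)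
Definition nonmonotone_run (u0 : H) (alpha0 : K) (u : nat -> H)
    (alpha : nat -> K) : Prop :=
  u 0%N = u0 /\
  forall k, (forall j, (j <= k)%N -> ~ stop_test (u j)) ->
    algorithm_step alpha0 u alpha k.

Definition terminates_at (u : nat -> H) (N : nat) : Prop :=
  stop_test (u N) /\ forall j, (j < N)%N -> ~ stop_test (u j).

Definition never_stops (u : nat -> H) : Prop := forall k, ~ stop_test (u k).

End ProximalGradient.

(* Main.v *)
Require Import Defs.
From mathcomp Require Import all_boot all_order all_algebra.
From mathcomp Require Import sesquilinear.
From mathcomp Require Import all_classical all_reals all_analysis.
From mathcomp Require Import ring lra zify.
Set Implicit Arguments.
Unset Strict Implicit.
Unset Printing Implicit Defensive.
Import Order.TTheory GRing.Theory Num.Theory.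
Import numFieldNormedType.Exports.
Local Open Scope classical_set_scope.
Local Open Scope ring_scope.

(** Write T_a for the map prox_grad with parameter a and G_a for grad_map. The
proximal point p of x with parameter a is characterized by the inclusion of
a (x - p) in the subdifferential of R at p. Hence the vector G_a u - grad F u is a
subgradient of R at T_a u (prox_grad_subgradient), and a fixed point of T_a is
stationary, which settles the case where the algorithm stops. Monotonicity of the
subdifferential gives two estimates: the norm of G_a u is nondecreasing in a
(grad_map_le), and one step multiplies the norm of the gradient mapping by at
most 1 + L / a (grad_map_next).

Adding the subgradient inequality to the quadratic upper bound of F (descent)
shows that every step size above L / (2 (1 - delta)) passes the test even against
the current value alone (objective_descent). A step size that has failed the test
is therefore below this threshold, and the accepted one, which is eta times the
last one that failed unless it is the first trial, is at most alpha_bar.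

Let c_k be the decrease that the accepted step guarantees, a fixed multiple of the
squared norm of the gradient mapping. The maximum of Psi over a window of m_max + 1
iterates is nonincreasing and bounded below, hence it converges; over m_max + 1
further steps it drops by at least the smallest of m_max + 1 consecutive values of
c. These values are comparable, because the ratios c_(k+1) / c_k are bounded, so
that the whole sequence c tends to 0 (window_descent_cvg0): this is (i).

For (ii), let d be a common lower bound of the c_i. Following the index at which
the maximum is attained, each descent by d moves the index back by at most
m_max + 1, so k steps descend by at least k d / (m_max + 1)
(window_descent_linear). This gives the estimate with the factor 1 in place of
C_G ^ m_max, and C_G >= 1.

For (iii), let u_(phi n) converge weakly to w. By (i) the next iterates also
converge weakly to w, and their subgradients G - grad F are bounded, which forces w
into the domain of R, hence into the interior of the domain of F. There the
gradients converge strongly to grad F w, so the subgradients converge strongly to its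
opposite; the graph of the subdifferential is closed under weak convergence of
points and strong convergence of subgradients (subdifferential_demiclosed). *)

(** * Inner products *)

Section InnerProduct.
Context {K : realType} {H : completeNormedModType K}.
Variable dot : {dot H for idfun}.
Hypothesis hilb : is_hilbert dot.
Implicit Types u v w : H.

Lemma dotC u v : dot u v = dot v u.
Proof. by rewrite hermC expr0 mul1r. Qed.

Lemma dotZl (a : K) u v : dot (a *: u) v = a * dot u v.
Proof. by rewrite linearZl_LR. Qed.

Lemma dotZr (a : K) u v : dot u (a *: v) = a * dot u v.
Proof. by rewrite dotC dotZl dotC. Qed.

Lemma normD_sqr u v : `|u + v| ^+ 2 = `|u| ^+ 2 + 2 * dot u v + `|v| ^+ 2.
Proof.
by rewrite -!hilb linearDr !linearDl /= (dotC v u); ring.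
Qed.

Lemma normB_sqr u v : `|u - v| ^+ 2 = `|u| ^+ 2 - 2 * dot u v + `|v| ^+ 2.
Proof. by rewrite normD_sqr normrN linearNr; ring. Qed.

(** Cauchy-Schwarz: expand the squared norm of |u| v - |v| u, which is
nonnegative. *)
Lemma dot_le u v : dot u v <= `|u| * `|v|.
Proof.
have [->|u0] := eqVneq u 0; first by rewrite linear0l normr0 mul0r.
have nu : 0 < `|u| by rewrite normr_gt0.
have := exprn_ge0 2 (normr_ge0 (`|u| *: v - `|v| *: u)).
rewrite normB_sqr !normrZ !normr_id dotZl dotZr (dotC v u) !exprMn => h.
have [->|v0] := eqVneq v 0; first by rewrite linear0r normr0 mulr0.
have nv : 0 < `|v| by rewrite normr_gt0.
have huv : 0 < `|u| * `|v| by rewrite mulr_gt0.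
have : 0 <= 2 * (`|u| * `|v|) * (`|u| * `|v| - dot u v).
  by move: h; congr (_ <= _); ring.
by rewrite pmulr_rge0 ?subr_ge0// mulr_gt0.
Qed.

Lemma ler_norm_dot u v : `|dot u v| <= `|u| * `|v|.
Proof.
rewrite ler_norml dot_le andbT lerNl -linearNl.
by rewrite (le_trans (dot_le _ _)) ?normrN.
Qed.

End InnerProduct.

(** * Proper convex lower semicontinuous functions *)

Section Convex.
Context {K : realType} {H : completeNormedModType K}.
Variable R : H -> \bar K.
Hypotheses (Rproper : proper_ereal R) (Rconvex : convex_ereal R).
Hypothesis Rlsc : lower_semicontinuous R.
Implicit Types (u v : H) (t : K).

Lemma edom_fin_num u : edom R u -> R u \is a fin_num.
Proof. by move=> Ru; rewrite fin_real// Rproper.1. Qed.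

Lemma convex_edom u v t : edom R u -> edom R v -> 0 <= t -> t <= 1 ->
  edom R (t *: u + (1 - t) *: v).
Proof.
move=> Ru Rv t0 t1; rewrite /edom /=.
apply: (le_lt_trans (Rconvex u v t0 t1)).
by rewrite -(fineK (edom_fin_num Ru)) -(fineK (edom_fin_num Rv)) -!EFinM -EFinD ltry.
Qed.

Lemma convex_fine u v t : edom R u -> edom R v -> 0 <= t -> t <= 1 ->
  fine (R (t *: u + (1 - t) *: v)) <= t * fine (R u) + (1 - t) * fine (R v).
Proof.
move=> Ru Rv t0 t1; rewrite -lee_fin EFinD !EFinM.
rewrite !fineK ?edom_fin_num//; first exact: Rconvex.
exact: convex_edom.
Qed.

(** Lower semicontinuity bounds R below on a ball around a point x0 of its domain.
For v outside that ball, the segment from x0 to v meets the ball, and convexity on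
this segment propagates the bound to v with a loss linear in |v - x0|. This growth
condition takes the place of an affine minorant. *)
Lemma lower_linear_bound : exists b c : K, 0 <= b /\
  forall v, ((c - b * `|v|)%:E <= R v)%E.
Proof.
have [_ [x0 dx0]] := Rproper; pose r0 := fine (R x0).
have Rx0 : R x0 = r0%:E by rewrite fineK// edom_fin_num.
have [|V] := @Rlsc x0 (r0 - 1); first by rewrite Rx0 lte_fin; lra.
move=> /nbhs_ballP[r /= r_gt0 rV] RV.
have near_x0 v : `|x0 - v| < r -> ((r0 - 1)%:E < R v)%E.
  by move=> hv; apply/RV/rV; rewrite -ball_normE.
suff bound v : ((r0 - 1 - 2 / r * `|v - x0|)%:E <= R v)%E.
  exists (2 / r), (r0 - 1 - 2 / r * `|x0|); split; first by rewrite divr_ge0// ltW.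
  move=> v; apply: le_trans (bound v); rewrite lee_fin.
  have := ler_normB v x0.
  have : 0 <= 2 / r by rewrite divr_ge0// ltW.
  by nra.
have r2 : 0 <= 2 / r by rewrite divr_ge0// ltW.
have [vr|vr] := ltP `|x0 - v| r.
  apply: le_trans (ltW (near_x0 v vr)); rewrite lee_fin.
  by rewrite gerBl// mulr_ge0.
have nv : 0 < `|v - x0| by rewrite distrC; exact: lt_le_trans vr.
have [dv|] := boolP (R v < +oo)%E; last first.
  by rewrite -leNgt leye_eq => /eqP ->; rewrite leey.
have Rv : R v = (fine (R v))%:E by rewrite fineK// edom_fin_num.
(* The point t v + (1 - t) x0 lies at distance r / 2 from x0. *)
set t := r / (2 * `|v - x0|).
have t0 : 0 < t by rewrite divr_gt0// mulr_gt0.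
have t1 : t <= 1.
  rewrite ler_pdivrMr ?mulr_gt0// mul1r.
  by move: vr; rewrite distrC; lra.
have := convex_fine dv dx0 (ltW t0) t1.
have : ((r0 - 1)%:E < R (t *: v + (1 - t) *: x0)%R)%E.
  apply: near_x0; rewrite (_ : x0 - _ = t *: (x0 - v)).
    rewrite normrZ (gtr0_norm t0) distrC /t.
    have -> : r / (2 * `|v - x0|) * `|v - x0| = r / 2.
      by field; rewrite gt_eqF.
    by lra.
  by rewrite scalerBl scale1r scalerBr addrCA opprD addrA subrr add0r opprB.
rewrite -[X in (_ < X)%E]fineK ?edom_fin_num//; last first.
  by apply: convex_edom => //; exact: ltW.
rewrite lte_fin -/r0 => h1 h2.
rewrite Rv lee_fin.
have h3 : -1 < t * (fine (R v) - r0) by lra.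
have h4 : t * (2 / r * `|v - x0|) = 1.
  by rewrite /t; field; rewrite !gt_eqF.
have : 0 < t * (fine (R v) - r0 + 2 / r * `|v - x0|) by lra.
by rewrite pmulr_rgt0//; lra.
Qed.

End Convex.

(** * Proximal points and subgradients *)

Section Prox.
Context {K : realType} {H : completeNormedModType K}.
Variable dot : {dot H for idfun}.
Hypothesis hilb : is_hilbert dot.
Variable R : H -> \bar K.
Hypotheses (Rproper : proper_ereal R) (Rconvex : convex_ereal R).
Hypothesis Rlsc : lower_semicontinuous R.
Implicit Types (u v w x p g h : H) (a t : K).

(** The objective is bounded below since its quadratic term dominates the linear
lower bound of R. Its strong convexity makes every minimizing sequence Cauchy, and
lower semicontinuity makes the limit a minimizer. *)
Lemma prox_attained a x : 0 < a ->
  exists p, argmin_set (fun v => (R v + (a / 2 * `|v - x| ^+ 2)%:E)%E) p.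
Proof.
move=> a0.
pose phi v := fine (R v) + a / 2 * `|v - x| ^+ 2.
have phiE v : edom R v -> (R v + (a / 2 * `|v - x| ^+ 2)%:E)%E = (phi v)%:E.
  by move=> dv; rewrite EFinD fineK// edom_fin_num.
pose S := phi @` edom R.
have [b [c [b0 Rge]]] := lower_linear_bound Rproper Rconvex Rlsc.
have lbS : lbound S (c - b * `|x| - b ^+ 2 / (2 * a)).
  move=> _ [v dv <-]; rewrite /phi.
  have := Rge v; rewrite -(fineK (edom_fin_num Rproper dv)) lee_fin => h1.
  have h2 : `|v| <= `|v - x| + `|x| by rewrite -{1}(subrK x v) ler_normD.
  have h3 : 0 <= (a * `|v - x| - b) ^+ 2 / (2 * a).
    by rewrite divr_ge0 ?sqr_ge0// mulr_ge0// ltW.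
  have h4 : (a * `|v - x| - b) ^+ 2 / (2 * a) =
      a / 2 * `|v - x| ^+ 2 - b * `|v - x| + b ^+ 2 / (2 * a).
    by field; rewrite gt_eqF.
  have h5 : b * `|v| <= b * (`|v - x| + `|x|) by rewrite ler_wpM2l.
  lra.
have hS : has_inf S.
  split; last by exists (c - b * `|x| - b ^+ 2 / (2 * a)).
  by have [_ [v dv]] := Rproper; exists (phi v), v.
have Sge v : edom R v -> inf S <= phi v.
  by move=> dv; apply: ge_inf; [exact: hS.2|exists v].
have /choice[v Pv] (n : nat) :
    exists v, edom R v /\ phi v < inf S + n.+1%:R^-1.
  have n0 : 0 < n.+1%:R^-1 :> K by rewrite invr_gt0.
  by have [_ [w dw <-] ?] := inf_adherent n0 hS; exists w.
(* The value at the midpoint of v m and v n is at least the infimum. *)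
have close m n :
    a / 8 * `|v m - v n| ^+ 2 <= (m.+1%:R^-1 + n.+1%:R^-1) / 2.
  have [[dm pm] [dn pn]] := (Pv m, Pv n).
  have h0 : 0 <= 2^-1 :> K by lra.
  have h1 : 2^-1 <= 1 :> K by lra.
  have := Sge _ (convex_edom Rproper Rconvex dm dn h0 h1).
  have := convex_fine Rproper Rconvex dm dn h0 h1.
  rewrite /phi; set w := (_ + _ *: _).
  have -> : w - x = 2^-1 *: (v m - x) + 2^-1 *: (v n - x).
    have half2 : 1 - 2^-1 = 2^-1 :> K by lra.
    rewrite /w half2 -!scalerDr addrACA -opprD scalerBr; congr (_ - _).
    by rewrite scalerDr -scalerDl (_ : 2^-1 + 2^-1 = 1) ?scale1r//; lra.
  have -> : v m - v n = (v m - x) - (v n - x) by rewrite opprB addrA subrK.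
  rewrite [`|_ *: _ + _| ^+ 2](normD_sqr hilb) (normB_sqr hilb).
  rewrite !normrZ dotZl dotZr !exprMn.
  have -> : `|2^-1 : K| = 2^-1 by rewrite ger0_norm.
  move: pm pn; rewrite /phi; set D := dot _ _.
  set A := `|v m - x| ^+ 2; set B := `|v n - x| ^+ 2 => pm pn.
  set r := fine (R w); set rm := fine (R (v m)); set rn := fine (R (v n)).
  rewrite -/rm -/rn in pm pn *.
  move: (inf S) (m.+1%:R^-1) (n.+1%:R^-1) pm pn => I im jn.
  lra.
have vcvg : cvgn v.
  apply/cauchy_cvgP/cauchyP => e e0.
  have e8 : 0 < a / 8 * e ^+ 2 by rewrite !mulr_gt0// exprn_gt0.
  have [N _ small] := near_infty_natSinv_lt (PosNum e8).
  exists (v N); exists N => // n Nn; rewrite /= -ball_normE /=.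
  rewrite -(@ltr_pXn2r _ 2)// ?nnegrE ?(ltW e0)//.
  rewrite -(@ltr_pM2l _ (a / 8)) ?divr_gt0//.
  apply: (le_lt_trans (close N n)).
  have := small N (leqnn _); have := small n Nn; rewrite /=.
  by move: (a / 8 * e ^+ 2) (N.+1%:R^-1) (n.+1%:R^-1) => E x1 x2; lra.
pose p := limn v.
have distp : (fun n => a / 2 * `|v n - x| ^+ 2) @ \oo --> a / 2 * `|p - x| ^+ 2.
  apply: cvgMr; rewrite expr2.
  have : (fun n => `|v n - x|) @ \oo --> `|p - x|.
    by apply: cvg_norm; apply: cvgB => //; exact: cvg_cst.
  by move=> h; exact: (cvgM h h).
(* Comparing reals below R p instead of R p itself covers R p = +oo. *)
have below r : (r%:E < R p)%E -> r + a / 2 * `|p - x| ^+ 2 <= inf S.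
  move=> /(Rlsc)[V pV RV].
  have vV : \forall n \near \oo, V (v n) by exact: (vcvg V pV).
  rewrite -[leRHS]addr0.
  apply: (ler_cvg_to (cvgD (cvg_cst r) distp) (cvgD (cvg_cst (inf S)) cvg_harmonic)).
  near=> n.
    have [dn pn] := Pv n.
    apply: (le_trans _ (ltW pn)); rewrite lerD2r -lee_fin.
    rewrite (fineK (edom_fin_num Rproper dn)).
    by apply/ltW/RV; near: n.
have dp : edom R p.
  rewrite /edom/= ltey; apply/eqP => Rp.
  by have := below (inf S + 1 - a / 2 * `|p - x| ^+ 2); rewrite Rp => /(_ (ltry _)); lra.
have phip : phi p <= inf S.
  apply/ler_addgt0Pr => e e0.
  have := below (fine (R p) - e).
  rewrite -[X in (_ < X)%E -> _](fineK (edom_fin_num Rproper dp)) lte_fin /phi.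
  move=> h; have : fine (R p) - e < fine (R p) by lra.
  by move=> /h; lra.
exists p => w; have [dw|] := boolP (R w < +oo)%E.
  by rewrite (phiE _ dp) (phiE _ dw) lee_fin (le_trans phip)// Sge.
by rewrite -leNgt leye_eq => /eqP ->; rewrite addye// leey.
Unshelve. all: by end_near. Qed.

(** Optimality condition: compare the minimizer p with t v + (1 - t) p, divide by
t, and let t tend to 0. *)
Lemma prox_subgradient a x : 0 < a ->
  subdifferential dot R (prox R a x) (a *: (x - prox R a x)).
Proof.
move=> a0; have := xgetPex 0 (prox_attained x a0); rewrite -/(prox R a x).
set p := prox R a x => pmin.
have dp : edom R p.
  have [_ [v dv]] := Rproper; rewrite /edom /= ltey; apply/eqP => Rp.
  have := pmin v; rewrite Rp addye// leye_eq -(fineK (edom_fin_num Rproper dv)).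
  by rewrite -EFinD.
split=> [|v]; first exact: edom_fin_num.
have [dv|] := boolP (R v < +oo)%E; last first.
  by rewrite -leNgt leye_eq => /eqP ->; rewrite leey.
have fp := fineK (edom_fin_num Rproper dp).
have fv := fineK (edom_fin_num Rproper dv).
rewrite -fp -fv -EFinD lee_fin dotZl.
have key t : 0 < t -> t <= 1 ->
    fine (R p) + a * dot (x - p) (v - p) <=
    fine (R v) + t * (a / 2 * `|v - p| ^+ 2).
  move=> t0 t1.
  have := pmin (t *: v + (1 - t) *: p).
  have dq := convex_edom Rproper Rconvex dv dp (ltW t0) t1.
  rewrite -fp -(fineK (edom_fin_num Rproper dq)) -!EFinD lee_fin.
  have := convex_fine Rproper Rconvex dv dp (ltW t0) t1.
  move: (fine (R (t *: v + (1 - t) *: p))) => q.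
  have -> : t *: v + (1 - t) *: p - x = t *: (v - p) - (x - p).
    rewrite scalerBl scale1r scalerBr opprB !addrA; congr (_ - _).
    by rewrite addrAC.
  rewrite [`|_ *: _ - _| ^+ 2](normB_sqr hilb) dotZl normrZ exprMn (gtr0_norm t0).
  rewrite -[`|p - x|]normrN opprB (dotC dot (v - p)).
  move: (dot (x - p) (v - p)) (`|x - p| ^+ 2) (`|v - p| ^+ 2) => D A B h1 h2.
  have h3 : 0 <= t * (fine (R v) + t * (a / 2 * B) - fine (R p) - a * D) by nra.
  by move: h3; rewrite pmulr_rge0//; lra.
apply/ler_addgt0Pr => e e0.
set B := a / 2 * `|v - p| ^+ 2 in key.
have B0 : 0 <= B by apply: mulr_ge0; [rewrite divr_ge0// ltW|rewrite exprn_ge0].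
(* Choosing t = e / (B + e) makes t <= 1 and the error t B at most e. *)
have Be : 0 < B + e by lra.
apply: le_trans (key (e / (B + e)) _ _) _.
- by rewrite divr_gt0.
- by rewrite ler_pdivrMr//; lra.
- by rewrite lerD2l mulrAC ler_pdivrMr// ler_wpM2l ?(ltW e0)//; lra.
Qed.

Lemma subdifferential_monotone p q g h :
  subdifferential dot R p g -> subdifferential dot R q h ->
  0 <= dot (g - h) (p - q).
Proof.
move=> [fp Hp] [fq Hq].
have := Hp q; have := Hq p; rewrite -(fineK fp) -(fineK fq) -!EFinD !lee_fin.
by rewrite -(opprB p q) linearNr linearBl; lra.
Qed.

(** Sublevel sets of R are weakly sequentially closed. With p the proximal point of
w for a large parameter a, the subgradient inequality at p is affine in v n and
passes to the weak limit, giving R p + a |w - p|^2 <= c. If c < R w, then by lower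
semicontinuity p stays at distance at least e from w, since R p <= c; the
quadratic term then exceeds the linear lower bound of R for large a. *)
Lemma weak_cvg_sublevel (v : nat -> H) w c : weak_cvg dot v w ->
  (\forall n \near \oo, (R (v n) <= c%:E)%E) -> (R w <= c%:E)%E.
Proof.
move=> vw Rv; rewrite leNgt; apply/negP => /Rlsc[V /nbhs_ballP[e /= e0 eV] RV].
have [b [d [b0 Rge]]] := lower_linear_bound Rproper Rconvex Rlsc.
have key a : 0 < a -> exists2 D, e <= D & a * D ^+ 2 <= c - d + b * (D + `|w|).
  move=> a0; have [fp Hp] := prox_subgradient w a0.
  set p := prox R a w in fp Hp.
  have Rp : fine (R p) + a * `|w - p| ^+ 2 <= c.
    have lim1 : (fun n => fine (R p) + a * dot (v n - p) (w - p)) @ \oo -->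
        fine (R p) + a * dot (w - p) (w - p).
      apply: cvgD; first exact: cvg_cst.
      apply: cvgMr; rewrite linearBl /=.
      rewrite (_ : (fun n => _) = (fun n => dot (v n) (w - p) - dot p (w - p))).
        by apply: cvgB; [exact: vw|exact: cvg_cst].
      by apply/funext => n; rewrite linearBl.
    rewrite -hilb; apply: (ler_cvg_to lim1 (cvg_cst c)); near=> n.
    rewrite -lee_fin EFinD (fineK fp) -dotZr dotC.
    by apply: le_trans (Hp (v n)) _; near: n.
  have wp : e <= `|w - p|.
    rewrite leNgt; apply/negP => h.
    have := RV p (eV p _); rewrite -ball_normE/= => /(_ h).
    rewrite -(fineK fp) lte_fin.
    have : 0 <= a * `|w - p| ^+ 2 by rewrite mulr_ge0 ?exprn_ge0// ltW.
    by lra.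
  exists `|w - p| => //.
  have := Rge p; rewrite -(fineK fp) lee_fin.
  have : `|p| <= `|w - p| + `|w|.
    by rewrite -{1}(subKr w p) (le_trans (ler_normB _ _))// addrC.
  move=> /(ler_wpM2l b0); lra.
(* For a = (b + M / e) / e and D >= e, the value a D^2 >= b D + M exceeds the
   upper bound in key. *)
pose M := `|c - d + b * `|w| | + 1.
have M0 : 0 < M by rewrite /M; have := normr_ge0 (c - d + b * `|w|); lra.
have Me : 0 < M / e by rewrite divr_gt0.
have a0 : 0 < (b + M / e) / e by rewrite divr_gt0//; lra.
have [D eD] := key _ a0.
have De : 1 <= D / e by rewrite ler_pdivlMr// mul1r.
have -> : (b + M / e) / e * D ^+ 2 = (b * D + M * (D / e)) * (D / e).
  by field; rewrite gt_eqF.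
have bD : 0 <= b * D by rewrite mulr_ge0// (le_trans (ltW e0)).
have h1 : b * D <= b * D * (D / e) by rewrite ler_peMr.
have h2 : M <= M * (D / e) * (D / e).
  by rewrite -mulrA ler_peMr ?(ltW M0)// mulr_ege1.
have := ler_norm (c - d + b * `|w|).
rewrite mulrDl; move: h1 h2; rewrite /M; move: (_ * _ * (D / e)) (_ * _ * (D / e)).
by move=> ? ?; lra.
Unshelve. all: by end_near. Qed.

End Prox.

(** * The quadratic upper bound *)

Section Descent.
Context {K : realType} {H : completeNormedModType K}.
Variable dot : {dot H for idfun}.
Hypothesis hilb : is_hilbert dot.
Implicit Types (u h : H) (t : K).

Lemma lipschitz_le (g : H -> H) (L : K) : L.-lipschitz g ->
  forall u v, `|g u - g v| <= L * `|u - v|.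
Proof. by move=> gL u v; exact: (gL (u, v)). Qed.

Lemma is_derive_line (f : H -> K) u h t : differentiable f (t *: h + u) ->
  is_derive t 1 (fun s : K => f (s *: h + u)) ('d f (t *: h + u) h).
Proof.
move=> df; pose l (s : K) := s *: h + u.
have dl : is_diff t l ( *:%R^~ h).
  have -> : l = ( *:%R^~ h : K -> H) + cst u by [].
  by apply: is_diff_eq; rewrite addr0.
have dl' : differentiable l t by exact: ex_diff.
have dfl : differentiable (f \o l) t by exact: differentiable_comp.
apply: DeriveDef; first exact: diff_derivable.
by rewrite (deriveE _ dfl) diff_comp//= diff_val scale1r.
Qed.

(** Subtract from t |-> f (t h + u) its linearization at 0 and the parabola
L / 2 |h|^2 t^2: the Lipschitz condition makes the derivative of the difference
nonpositive on [0, 1]. *)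
Lemma descent (f : H -> K) (g : H -> H) (L : K) u h :
  (forall t, 0 <= t -> t <= 1 -> differentiable f (t *: h + u) /\
     'd f (t *: h + u) h = dot (g (t *: h + u)) h) ->
  L.-lipschitz g ->
  f (h + u) <= f u + dot (g u) h + L / 2 * `|h| ^+ 2.
Proof.
move=> df /lipschitz_le gL.
pose q := (fun s : K => f (s *: h + u)) - (dot (g u) h \*: id)
    - ((L / 2 * `|h| ^+ 2) \*: (id ^+ 2)).
have dq t : 0 <= t -> t <= 1 ->
    is_derive t 1 q (dot (g (t *: h + u) - g u) h - L * t * `|h| ^+ 2).
  move=> t0 t1; have [d1 d2] := df t t0 t1.
  have := is_derive_line d1; rewrite d2 => d3.
  apply: is_derive_eq; rewrite linearBl /GRing.scale/= expr1.
  by field.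
have [c] : exists2 c, c \in `[(0:K), 1] & q 1 - q 0 =
    (dot (g (c *: h + u) - g u) h - L * c * `|h| ^+ 2) * (1 - 0).
  apply: MVT_segment => // [x|].
    by rewrite in_itv/= => /andP[/ltW x0 /ltW x1]; exact: dq.
  apply: continuous_in_subspaceT => x; rewrite inE/= in_itv/= => /andP[x0 x1].
  apply: differentiable_continuous; apply/derivable1_diffP.
  by have := dq x x0 x1; case.
rewrite in_itv/= => /andP[c0 c1].
have -> : q 1 = f (h + u) - dot (g u) h - L / 2 * `|h| ^+ 2.
  rewrite -[q 1]/(f (1 *: h + u) - dot (g u) h * 1
    - (L / 2 * `|h| ^+ 2) * (1 * 1)).
  by rewrite scale1r !mulr1.
have -> : q 0 = f u.
  rewrite -[q 0]/(f (0 *: h + u) - dot (g u) h * 0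
    - (L / 2 * `|h| ^+ 2) * (0 * 0)).
  by rewrite scale0r add0r !mulr0 !subr0.
have : dot (g (c *: h + u) - g u) h <= L * c * `|h| ^+ 2.
  apply: le_trans (dot_le hilb _ _) _.
  rewrite expr2 mulrA ler_wpM2r//.
  by have := gL (c *: h + u) u; rewrite addrK normrZ (ger0_norm c0) mulrA.
by move: (L * c * _) (L / 2 * _) (dot _ _) => A B C; lra.
Qed.

End Descent.

(** * The gradient mapping *)

Section GradientMapping.
Context {K : realType} {H : completeNormedModType K}.
Variables (dot : {dot H for idfun}) (F R : H -> \bar K) (gradF : H -> H) (L : K).
Hypothesis hilb : is_hilbert dot.
Hypotheses (Rproper : proper_ereal R) (Rconvex : convex_ereal R).
Hypothesis Rlsc : lower_semicontinuous R.
Hypothesis L0 : 0 < L.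
Hypothesis gradL : L.-lipschitz gradF.
Implicit Types (u v w : H) (a b : K).

Local Notation T := (prox_grad R gradF).
Local Notation G := (grad_map R gradF).

(** The inclusion of a (x - p) in the subdifferential at the proximal point p of
x, for x = u - grad F u / a. *)
Lemma prox_grad_subgradient a u : 0 < a ->
  subdifferential dot R (T a u) (G a u - gradF u).
Proof.
move=> a0; have := prox_subgradient hilb Rproper Rconvex Rlsc (u - a^-1 *: gradF u) a0.
rewrite -/(T a u); congr (subdifferential dot R _ _).
by rewrite /grad_map addrAC scalerBr scalerA divff ?gt_eqF// scale1r.
Qed.

Lemma prox_grad_edom a u : 0 < a -> edom R (T a u).
Proof.
by move=> a0; have [+ _] := prox_grad_subgradient u a0; rewrite fin_numElt => /andP[].
Qed.

Lemma stop_test_stationary u : stop_test R gradF u -> stationary dot R gradF u.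
Proof.
move=> [a a0 Gau]; have := prox_grad_subgradient u a0; rewrite Gau sub0r.
have -> // : T a u = u.
apply/esym/eqP; rewrite -subr_eq0; move/eqP: Gau.
by rewrite /grad_map scaler_eq0 gt_eqF.
Qed.

Lemma norm_grad_map a u : 0 < a -> `|G a u| = a * `|u - T a u|.
Proof. by move=> a0; rewrite normrZ gtr0_norm. Qed.

(** With X = |u - T_a u| and Y = |u - T_b u|, monotonicity of the subdifferential
between T_a u and T_b u and Cauchy-Schwarz give (a X - b Y) (X - Y) <= 0. If
b Y > a X, then Y > X because b <= a, and the product would be positive. *)
Lemma grad_map_le a b u : 0 < b -> b <= a -> `|G b u| <= `|G a u|.
Proof.
move=> b0 ba; have a0 := lt_le_trans b0 ba.
have := subdifferential_monotone (prox_grad_subgradient u a0) (prox_grad_subgradient u b0).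
rewrite !norm_grad_map// /grad_map opprB addrA subrK.
set x := u - T a u; set y := u - T b u.
have -> : T a u - T b u = y - x by rewrite /x /y opprB [RHS]addrC addrA subrK.
clearbody x y; rewrite linearBl !linearBr /= !dotZl !hilb (dotC dot y x) => h.
have := dot_le hilb x y; have := normr_ge0 x; have := normr_ge0 y.
move: `|x| `|y| (dot x y) h => X Y D h Y0 X0 DXY.
have h1 : (a * X - b * Y) * (X - Y) <= 0.
  have : (a + b) * D <= (a + b) * (X * Y) by rewrite ler_wpM2l// addr_ge0// ltW.
  by lra.
rewrite leNgt; apply/negP => h2.
have XY : X < Y.
  rewrite ltNge; apply/negP => YX.
  have : b * Y <= a * X by rewrite ler_pM// ltW.
  by lra.
have : 0 < (b * Y - a * X) * (Y - X) by rewrite mulr_gt0// subr_gt0.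
by lra.
Qed.

(** Monotonicity of the subdifferential between two consecutive iterates v = T_a u
and T_b v, tested against their difference G_b v / b, compares |G_b v|^2 with the
inner product of G_a u + grad F v - grad F u and G_b v. *)
Lemma grad_map_next a b u : 0 < a -> 0 < b ->
  `|G b (T a u)| <= (1 + L / a) * `|G a u|.
Proof.
move=> a0 b0; set v := T a u; set w := T b v.
have := subdifferential_monotone (prox_grad_subgradient u a0) (prox_grad_subgradient v b0).
rewrite -/v -/w.
have -> : v - w = b^-1 *: G b v by rewrite scalerA mulVf ?gt_eqF// scale1r.
rewrite dotZr pmulr_rge0 ?invr_gt0// !linearBl /= hilb => h.
have [->|Gb0] := eqVneq (G b v) 0.
  rewrite normr0 mulr_ge0// addr_ge0// divr_ge0// ltW//.
have nG : 0 < `|G b v| by rewrite normr_gt0.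
rewrite -(ler_pM2l nG).
have h1 := dot_le hilb (G a u) (G b v).
have h2 := dot_le hilb (gradF v - gradF u) (G b v).
have h3 : `|gradF v - gradF u| <= L / a * `|G a u|.
  apply: le_trans (lipschitz_le gradL _ _) _.
  by rewrite distrC norm_grad_map// mulrA mulfVK ?gt_eqF.
have h4 := ler_wpM2r (ltW nG) h3.
rewrite linearBl /= in h2.
by rewrite mulrDl mul1r mulrDr; lra.
Qed.

Hypothesis Fproper : forall v, (-oo < F v)%E.
Hypothesis domRF : edom R `<=` (edom F)°.
Hypothesis Fdiff : forall v, (edom F)° v -> differentiable (fine \o F) v.
Hypothesis gradFE : is_gradient dot F gradF.

Local Notation Psi := (objective F R).

Lemma edom_fin_numF u : edom R u -> F u \is a fin_num.
Proof. by move=> /domRF/interior_subset Fu; rewrite fin_real// Fproper. Qed.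

Lemma objective_edom u : edom R u -> Psi u = (fine (F u) + fine (R u))%:E.
Proof.
move=> Ru; rewrite EFinD !fineK//; [exact: edom_fin_num|exact: edom_fin_numF].
Qed.

(** Only the starting point of a run can lie outside the domain of R. *)
Lemma objective_pinfty u : ~ edom R u -> Psi u = +oo%E.
Proof.
rewrite /edom/= => /negP; rewrite -leNgt leye_eq /objective => /eqP ->.
by rewrite addey// -ltNye.
Qed.

(** The upper bound of F contributes L / 2 |u - T_a u|^2 and the subgradient
inequality at T_a u contributes - a |u - T_a u|^2; the inner products with grad F u
cancel. *)
Lemma objective_descent delta a u : edom R u -> delta < 1 -> 0 < a ->
  L / (2 * (1 - delta)) <= a ->
  (Psi (T a u) <= Psi u - (delta / a * `|G a u| ^+ 2)%:E)%E.
Proof.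
move=> du d1 a0 La; have dT := prox_grad_edom u a0.
rewrite !objective_edom// -EFinB lee_fin.
have Fdesc : fine (F (T a u)) <= fine (F u) + dot (gradF u) (T a u - u)
    + L / 2 * `|T a u - u| ^+ 2.
  have := @descent K H dot hilb (fine \o F) gradF L u (T a u - u) _ gradL.
  rewrite subrK; apply => t t0 t1.
  suff dt : (edom F)° (t *: (T a u - u) + u).
    by split; [exact: Fdiff|exact: gradFE].
  apply: domRF; rewrite (_ : _ + u = t *: T a u + (1 - t) *: u).
    exact: convex_edom.
  by rewrite scalerBr scalerBl scale1r -addrA [- _ + _]addrC.
have [_ /(_ u)] := prox_grad_subgradient u a0.
rewrite -(fineK (edom_fin_num Rproper dT)) -(fineK (edom_fin_num Rproper du)).
rewrite -EFinD lee_fin linearBl /= => Rdesc.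
have h1 : dot (G a u) (u - T a u) = a^-1 * `|G a u| ^+ 2.
  rewrite -hilb -dotZr; congr (dot _ _).
  by rewrite scalerA mulVf ?gt_eqF// scale1r.
have h2 : `|T a u - u| ^+ 2 = a^-1 ^+ 2 * `|G a u| ^+ 2.
  by rewrite norm_grad_map// distrC; field; rewrite gt_eqF.
rewrite h1 in Rdesc; rewrite h2 in Fdesc.
have h3 : dot (gradF u) (T a u - u) = - dot (gradF u) (u - T a u).
  by rewrite -linearNr opprB.
rewrite h3 in Fdesc.
have h4 : L / 2 * a^-1 ^+ 2 <= (1 - delta) * a^-1.
  move: La; rewrite ler_pdivrMr; last by rewrite mulr_gt0// subr_gt0.
  move=> La; rewrite expr2 mulrA ler_pM2r ?invr_gt0// ler_pdivrMr//; lra.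
have h5 := ler_wpM2r (exprn_ge0 2 (normr_ge0 (G a u))) h4.
rewrite -mulrA -/(G a u) in Fdesc *.
move: (`|G a u| ^+ 2) (dot _ _) Fdesc Rdesc h5 => N D.
lra.
Qed.

End GradientMapping.

(** * Sequences that descend below a window maximum *)

Section WindowDescent.
Context {K : realType}.
Implicit Types (f c : nat -> K) (m n : nat).

(** A step lowers the value by d and goes back from k + 1 to some k - j, that is by
at most m + 1 indices, so the average descent per index is at least d / (m + 1). *)
Lemma window_descent_linear f m n (d : K) : 0 <= d ->
  (forall k, (k < n)%N -> exists2 j, (j <= minn k m)%N & f k.+1 <= f (k - j)%N - d) ->
  forall k, (k <= n)%N -> k%:R * d <= m.+1%:R * (f 0%N - f k).
Proof.
move=> d0 fd; elim/ltn_ind => -[|k] IH kn; first by rewrite subrr mul0r mulr0.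
have [j] := fd k kn; rewrite leq_min => /andP[jk jm] fk.
have := IH (k - j)%N; rewrite ltnS leq_subr => /(_ isT).
move=> /(_ (leq_trans (leq_subr _ _) (ltnW kn))) fkj.
have h1 : k.+1%:R * d <= ((k - j)%N%:R + m.+1%:R) * d.
  by rewrite ler_wpM2r// -natrD ler_nat; lia.
have h2 : m.+1%:R * f k.+1 <= m.+1%:R * (f (k - j)%N - d) by rewrite ler_wpM2l.
lra.
Qed.

(** The window maxima M n are nonincreasing and bounded below. The m + 1 values of f
in the window that starts at n + m + 1 are below M n by at least c (n + m), ..., c (n + 2 m)
respectively, and each of these is at least c (n + 2 m) / C ^ m by the growth
condition. Hence c (n + 2 m) <= C ^ m (M n - M (n + m + 1)), which tends to 0. *)
Lemma window_descent_cvg0 f c m (C b : K) :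
  (forall k, 0 <= c k) -> 1 <= C -> (forall k, c k.+1 <= C * c k) ->
  (forall k, b <= f k) ->
  (forall k, exists2 j, (j <= m)%N & f (k + m).+1 <= f (k + m - j)%N - c (k + m)%N) ->
  c @ \oo --> (0 : K).
Proof.
move=> c0 C1 cC fb fd.
have Cp n : 0 < C ^+ n by rewrite exprn_gt0//; lra.
have cX k n : c (k + n)%N <= C ^+ n * c k.
  elim: n => [|n IH]; first by rewrite addn0 mul1r.
  rewrite addnS (le_trans (cC _))// exprS -mulrA ler_wpM2l//; lra.
pose M n := \big[Num.max/f n]_(j < m.+1) f (n + j)%N.
have fM n j : (j <= m)%N -> f (n + j)%N <= M n.
  rewrite -ltnS => jm.
  exact: (@le_bigmax _ _ _ _ (fun j : 'I_m.+1 => f (n + j)%N) (Ordinal jm)).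
have Mle n x : (forall j, (j <= m)%N -> f (n + j)%N <= x) -> M n <= x.
  move=> h; apply: bigmax_le; first by have := h 0%N isT; rewrite addn0.
  by move=> [j jm] _; exact: h.
have fS n : f (n + m).+1 <= M n - c (n + m)%N.
  have [j jm /le_trans] := fd n; apply.
  by rewrite lerD2r -addnBA// fM// leq_subr.
have Mdec n : M n.+1 <= M n.
  apply: Mle => j; rewrite leq_eqVlt => /orP[/eqP->|jm].
    by rewrite addSn (le_trans (fS n))// gerBl.
  by rewrite addSnnS fM.
have Mni : {homo M : n p / (n <= p)%N >-> p <= n}.
  move=> n p /subnK <-; elim: (p - n)%N => // i IH.
  by rewrite addSn (le_trans (Mdec _)).
have Mdrop n : M (n + m.+1)%N <= M n - (C ^+ m)^-1 * c (n + (m + m))%N.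
  apply: Mle => j jm.
  have -> : (n + m.+1 + j = (n + j + m).+1)%N by lia.
  apply: le_trans (fS _) _; apply: lerB; first by apply: Mni; rewrite leq_addr.
  rewrite ler_pdivrMl//.
  have -> : (n + (m + m) = n + j + m + (m - j))%N by lia.
  apply: le_trans (cX _ _) _; rewrite ler_wpM2r// ler_weXn2l//.
  by rewrite leq_subr.
have Mcvg : cvgn M.
  apply: nonincreasing_is_cvgn => //; exists b => _ [n _ <-].
  by apply: le_trans (fM n 0%N _); rewrite ?addn0.
have Mlim : (fun n => C ^+ m * (M n - M (n + m.+1)%N)) @ \oo --> (0 : K).
  rewrite -(mulr0 (C ^+ m)) -(subrr (limn M)); apply: cvgMr; apply: cvgB => //.
  by rewrite cvg_shiftn.
have : (fun n => c (n + (m + m))%N) @ \oo --> (0 : K).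
  apply: (squeeze_cvgr _ (cvg_cst 0) Mlim); near=> n.
  rewrite c0/= -ler_pdivrMl//.
  by have := Mdrop n; move: (_ * c _) => x; lra.
by rewrite cvg_shiftn.
Unshelve. all: by end_near. Qed.

End WindowDescent.

(** * Weak limits *)

Section WeakLimits.
Context {K : realType} {H : completeNormedModType K}.
Variable dot : {dot H for idfun}.
Hypothesis hilb : is_hilbert dot.
Implicit Types (u v p : nat -> H) (w z q : H).

(** Banach-Steinhaus for the functionals dot (v n), whose norms are the |v n|. *)
Lemma weak_cvg_bounded v w : weak_cvg dot v w -> exists M, forall n, `|v n| <= M.
Proof.
move=> vw; pose S : set (H -> K) := range (fun n => dot (v n)).
have SB f : S f -> bounded_fun_norm f /\ linear f.
  move=> [n _ <-]; split; last by move=> a x y; rewrite linearPr.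
  move=> r; exists (`|v n| * `|r|) => x xr.
  apply: le_trans (ler_norm_dot hilb _ _) _.
  by rewrite ler_wpM2l// (le_trans xr)// ler_norm.
have pS : pointwise_bounded S.
  move=> h; have /cvg_seq_bounded[M [_ /(_ (M + 1))]] : cvgn (fun n => dot (v n) h).
    by apply/cvg_ex; exists (dot w h); exact: vw.
  rewrite ltrDl ltr01 => /(_ isT) bM; exists (M + 1) => _ [n _ <-]; exact: bM.
have [M bM] := Banach_Steinhauss SB pS 1.
exists M => n; have [->|v0] := eqVneq (v n) 0.
  have := bM _ (ex_intro2 _ _ n I erefl) 0; rewrite normr0 => /(_ ler01).
  exact: le_trans.
have nv : 0 < `|v n| by rewrite normr_gt0.
have := bM _ (ex_intro2 _ _ n I erefl) (`|v n|^-1 *: v n).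
rewrite normrZ normfV normr_id mulVf ?gt_eqF// => /(_ (lexx _)).
by rewrite dotZr hilb expr2 mulKf ?gt_eqF// normr_id.
Qed.

Lemma weak_cvgD v w (e : nat -> H) : weak_cvg dot v w -> e @ \oo --> (0 : H) ->
  weak_cvg dot (v \+ e) w.
Proof.
move=> vw e0 h; rewrite -[dot w h]addr0.
rewrite [X in X @ _ --> _](_ : _ = (fun n => dot (v n) h + dot (e n) h)); last first.
  by apply/funext => n; rewrite /= linearDl.
apply: cvgD; first exact: vw.
apply/norm_cvg0P; apply: (squeeze_cvgr _ (cvg_cst 0)).
  by near=> n; rewrite normr_ge0/=; exact: (ler_norm_dot hilb).
rewrite -(mul0r `|h|); apply: cvgMl.
by rewrite -(@normr0 _ H); exact: cvg_norm.
Unshelve. all: by end_near. Qed.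

Lemma strong_weak_cvg_dot p q v w : p @ \oo --> q -> weak_cvg dot v w ->
  (fun n => dot (p n) (v n)) @ \oo --> dot q w.
Proof.
move=> pq vw; have [M vM] := weak_cvg_bounded vw.
rewrite [X in X @ _ --> _](_ : _ =
  (fun n => dot (p n - q) (v n) + dot (v n) q)); last first.
  by apply/funext => n; rewrite linearBl (dotC dot (v n)) subrK.
rewrite -[dot q w]add0r (dotC dot q); apply: cvgD; last exact: vw.
apply/norm_cvg0P; apply: (@squeeze_cvgr _ _ _ _ (cst 0) (fun n => `|p n - q| * M)).
- near=> n; rewrite normr_ge0/=; apply: le_trans (ler_norm_dot hilb _ _) _.
  by rewrite ler_wpM2l.
- exact: cvg_cst.
- rewrite -(mul0r M); apply: cvgMl.
  by rewrite -(@normr0 _ H) -(subrr q); apply: cvg_norm; apply: cvgB => //; exact: cvg_cst.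
Unshelve. all: by end_near. Qed.

Variable R : H -> \bar K.
Hypotheses (Rproper : proper_ereal R) (Rconvex : convex_ereal R).
Hypothesis Rlsc : lower_semicontinuous R.

(** The subgradient inequality between v n and one fixed z in the domain bounds
R (v n) above uniformly, so w belongs to a sublevel set of R. *)
Lemma weak_limit_edom p v w (B : K) : weak_cvg dot v w ->
  (forall n, subdifferential dot R (v n) (p n)) -> (forall n, `|p n| <= B) ->
  edom R w.
Proof.
move=> vw pv pB; have [M vM] := weak_cvg_bounded vw.
have [_ [z dz]] := Rproper; have fz := fineK (edom_fin_num Rproper dz).
apply: (le_lt_trans _ (ltry (fine (R z) + B * (`|z| + M)))).
apply: (weak_cvg_sublevel hilb Rproper Rconvex Rlsc vw); near=> n.
have [fv /(_ z)] := pv n; rewrite -(fineK fv) -fz -EFinD !lee_fin /=.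
have : - dot (p n) (z - v n) <= B * (`|z| + M).
  apply: le_trans (ler_norm _) _; rewrite normrN.
  apply: le_trans (ler_norm_dot hilb _ _) _; rewrite ler_pM//.
  by rewrite (le_trans (ler_normB _ _))// lerD2l.
by lra.
Unshelve. all: by end_near. Qed.

(** For a fixed z, the subgradient inequality bounds R (v n) above by quantities
converging to R z - dot q (z - w); weak closedness of sublevel sets turns this into
a bound on R w, up to e > 0. *)
Lemma subdifferential_demiclosed p q v w : weak_cvg dot v w -> p @ \oo --> q ->
  (forall n, subdifferential dot R (v n) (p n)) -> subdifferential dot R w q.
Proof.
move=> vw pq pv.
have sub z : edom R z -> (R w <= (fine (R z) - dot q (z - w))%:E)%E.
  move=> dz; apply/lee_addgt0Pr => e e0; rewrite -EFinD.
  have fz := fineK (edom_fin_num Rproper dz).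
  apply: (weak_cvg_sublevel hilb Rproper Rconvex Rlsc vw).
  have lim1 : (fun n => dot (p n) z - dot (p n) (v n)) @ \oo --> dot q (z - w).
    rewrite linearBr /=; apply: cvgB; last exact: strong_weak_cvg_dot.
    apply: strong_weak_cvg_dot => // h; exact: cvg_cst.
  have [N _ close] : \forall n \near \oo,
      dot q (z - w) - e < dot (p n) z - dot (p n) (v n).
    by apply: (cvgr_gt (dot q (z - w))) => //; lra.
  exists N => // n Nn; have := close n Nn; rewrite /= -linearBr.
  have [fv /(_ z)] := pv n; rewrite -(fineK fv) -fz -EFinD !lee_fin /=.
  by lra.
have dw : edom R w.
  by have [_ [z dz]] := Rproper; apply: (le_lt_trans (sub z dz)); exact: ltry.
split=> [|z]; first exact: edom_fin_num.
have [dz|] := boolP (R z < +oo)%E; last first.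
  by rewrite -leNgt leye_eq => /eqP ->; rewrite leey.
have := sub z dz; rewrite -(fineK (edom_fin_num Rproper dw)).
rewrite -[in X in _ -> X](fineK (edom_fin_num Rproper dz)) -EFinD !lee_fin.
by lra.
Qed.

End WeakLimits.

(** * Infinite runs of the algorithm *)

Section Run.
Context {K : realType} {H : completeNormedModType K}.
Variables (dot : {dot H for idfun}) (F R : H -> \bar K) (gradF : H -> H) (L : K).
Variables (delta eta alpha_inf alpha_sup alpha0 : K) (m_max : nat).
Variables (u : nat -> H) (alpha : nat -> K).
Hypothesis hilb : is_hilbert dot.
Hypotheses (Rproper : proper_ereal R) (Rconvex : convex_ereal R).
Hypothesis Rlsc : lower_semicontinuous R.
Hypothesis L0 : 0 < L.
Hypothesis gradL : L.-lipschitz gradF.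
Hypothesis Fproper : forall v, (-oo < F v)%E.
Hypothesis domRF : edom R `<=` (edom F)°.
Hypothesis Fdiff : forall v, (edom F)° v -> differentiable (fine \o F) v.
Hypothesis gradFE : is_gradient dot F gradF.
Hypothesis Psi_bounded : exists c : K, forall v, (c%:E <= objective F R v)%E.
Hypotheses (delta0 : 0 < delta) (delta1 : delta < 1) (eta1 : 1 < eta).
Hypotheses (ainf0 : 0 < alpha_inf) (ainf_sup : alpha_inf < alpha_sup).
Hypothesis run : forall k, algorithm_step dot F R gradF delta eta
  alpha_inf alpha_sup m_max alpha0 u alpha k.

Local Notation Psi := (objective F R).
Local Notation T := (prox_grad R gradF).
Local Notation G := (grad_map R gradF).
Let alpha_bar := Num.max (eta * L / (2 * (1 - delta))) alpha_sup.
Let f k := fine (Psi (u k)).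

Lemma memoryE k : memory m_max k = minn k m_max.
Proof. by elim: k => [|k IH] /=; lia. Qed.

Lemma sufficient_decrease_monotone k a :
  (Psi (T a (u k)) <= Psi (u k) - (delta / a * `|G a (u k)| ^+ 2)%:E)%E ->
  sufficient_decrease F R gradF delta m_max u k a.
Proof.
move=> h; apply: (le_trans h); rewrite leeD2r//.
have := @le_bigmax _ _ _ -oo%E
  (fun j : 'I_(memory m_max k).+1 => Psi (u (k - j)%N)) ord0.
by rewrite /= subn0.
Qed.

(** The window is never empty, so its maximum is attained. *)
Lemma sufficient_decrease_window k a :
  sufficient_decrease F R gradF delta m_max u k a ->
  exists2 j, (j <= minn k m_max)%N &
    (Psi (T a (u k)) <= Psi (u (k - j)%N) - (delta / a * `|G a (u k)| ^+ 2)%:E)%E.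
Proof.
rewrite /sufficient_decrease.
have [||[j jm] _ ->] := @eq_bigmax _ _ _ -oo%E (@ord0 (memory m_max k)) xpredT
    (fun j : 'I_(memory m_max k).+1 => Psi (u (k - j)%N)) => //.
  by move=> i _; rewrite leNye.
by exists j => //; rewrite -memoryE.
Qed.

(** If backtracking occurred, the trial value preceding alpha k failed the test, so
by objective_descent it is below L / (2 (1 - delta)), and alpha k is eta times
it. *)
Lemma step_size_bounds k : alpha_inf <= alpha k <= alpha_bar.
Proof.
have [aBB [i []]] := run k; set aint := Num.max _ _ => _ -> _ fails _.
have aint_ge : alpha_inf <= aint by rewrite le_max lexx.
have aint_le : aint <= alpha_sup.
  by rewrite ge_max (ltW ainf_sup)/= ge_min lexx.
have aint0 : 0 < aint := lt_le_trans ainf0 aint_ge.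
have eta0 : 0 < eta := lt_trans ltr01 eta1.
apply/andP; split.
  by rewrite (le_trans aint_ge)// ler_peMr ?(ltW aint0)// exprn_ege1// ltW.
rewrite /alpha_bar; case: i fails => [|i] fails.
  by rewrite expr0 mulr1 le_max aint_le orbT.
rewrite le_max; apply/orP; left.
set a := aint * eta ^+ i.
have a0 : 0 < a by rewrite mulr_gt0// exprn_gt0.
have : a < L / (2 * (1 - delta)).
  rewrite ltNge; apply/negP => La; apply: (fails i (ltnSn i)).
  apply: sufficient_decrease_monotone.
  have [du|/(objective_pinfty Fproper) ->] := pselect (edom R (u k)).
    exact: (objective_descent hilb Rproper Rconvex Rlsc gradL Fproper domRF Fdiff
      gradFE).
  by rewrite addye ?leey// -EFinN ltNye_eq.
by move=> La; rewrite exprSr mulrA mulrC -mulrA ler_wpM2l ?ltW.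
Qed.

Lemma step_size_gt0 k : 0 < alpha k.
Proof. by have /andP[+ _] := step_size_bounds k; exact: lt_le_trans. Qed.

Lemma iterateS k : u k.+1 = T (alpha k) (u k).
Proof. by have [? [? []]] := run k. Qed.

Lemma iterate_edom k : edom R (u k.+1).
Proof.
rewrite iterateS; apply: (prox_grad_edom _ hilb Rproper Rconvex Rlsc).
exact: step_size_gt0.
Qed.

Lemma alpha_bar_gt : alpha_inf < alpha_bar.
Proof. by rewrite lt_max ainf_sup orbT. Qed.

Lemma alpha_bar_gt0 : 0 < alpha_bar.
Proof. exact: lt_trans ainf0 alpha_bar_gt. Qed.

Lemma objective_fine k : edom R (u k) -> Psi (u k) = (f k)%:E.
Proof. by move=> du; rewrite /f (objective_edom Rproper Fproper domRF). Qed.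

(** Replacing alpha k by alpha_bar makes the guaranteed decrease the same multiple of
the squared gradient mapping at every step, as the lemmas on windows require. *)
Lemma window_decrease k :
  (forall j, (j <= minn k m_max)%N -> edom R (u (k - j)%N)) ->
  exists2 j, (j <= minn k m_max)%N &
    f k.+1 <= f (k - j)%N - delta / alpha_bar * `|G (alpha k) (u k)| ^+ 2.
Proof.
move=> dk; have [aBB [i [_ _ /sufficient_decrease_window[j jm +] _ _]]] := run k.
rewrite -iterateS !objective_fine//; [|exact: dk|exact: iterate_edom].
rewrite -EFinB lee_fin => h; exists j => //; apply: le_trans h _; rewrite lerB//.
have /andP[_ ab] := step_size_bounds k.
by rewrite ler_wpM2r// ler_pM2l// lef_pV2// posrE ?step_size_gt0// alpha_bar_gt0.
Qed.

Lemma grad_map_cvg0 : `|G (alpha k) (u k)| @[k --> \oo] --> (0 : K).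
Proof.
pose g k := `|G (alpha k) (u k)|.
pose c k := delta / alpha_bar * g k.+1 ^+ 2.
have g_ge0 k : 0 <= g k by exact: normr_ge0.
have d0 : 0 < delta / alpha_bar by rewrite divr_gt0// alpha_bar_gt0.
have [b Psib] := Psi_bounded.
have La0 : 0 <= L / alpha_inf by rewrite divr_ge0// ltW.
have gS k : g k.+1 <= (1 + L / alpha_inf) * g k.
  rewrite /g iterateS; apply: le_trans
    (grad_map_next hilb Rproper Rconvex Rlsc L0 gradL _ (step_size_gt0 k)
      (step_size_gt0 k.+1)) _.
  have /andP[ab _] := step_size_bounds k.
  by rewrite ler_wpM2r// lerD2l ler_pM2l// lef_pV2// posrE step_size_gt0.
have c_cvg : c @ \oo --> (0 : K).
  (* The shift by one leaves out the starting point, at which Psi may be +oo. *)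
  apply: (@window_descent_cvg0 _ (fun k => f k.+1) c m_max
    ((1 + L / alpha_inf) ^+ 2) b).
  - by move=> k; rewrite mulr_ge0 ?(ltW d0)// exprn_ge0.
  - by rewrite exprn_ege1// lerDl.
  - move=> k; rewrite /c [leRHS]mulrCA ler_pM2l// -exprMn.
    by rewrite ler_pXn2r ?nnegrE ?mulr_ge0 ?addr_ge0.
  - by move=> k; rewrite -lee_fin -objective_fine//; exact: iterate_edom.
  - move=> k; have [|j jm] := @window_decrease (k + m_max).+1.
      move=> j; rewrite leq_min => /andP[_ jm].
      by rewrite (_ : _ - j = (k + m_max - j).+1)%N; [exact: iterate_edom|lia].
    rewrite (_ : _ - j = (k + m_max - j).+1)%N; last by lia.
    by exists j => //; lia.
have g2 : (fun k => g k.+1 ^+ 2) @ \oo --> (0 : K).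
  rewrite (_ : (fun k => _) = (fun k => (delta / alpha_bar)^-1 * c k)).
    by rewrite -(mulr0 (delta / alpha_bar)^-1); exact: cvgMr.
  by apply/funext => k; rewrite /c mulKf// gt_eqF.
have : (fun k => g (k + 1)%N) @ \oo --> (0 : K).
  rewrite (_ : (fun k => _) = (fun k => Num.sqrt (g k.+1 ^+ 2))).
    by rewrite -(@sqrtr0 K); apply: continuous_cvg => //; exact: sqrt_continuous.
  by apply/funext => k; rewrite addn1 sqrtr_sqr ger0_norm.
by rewrite cvg_shiftn.
Qed.

(** Let mu be the minimum on the left. By grad_map_le it is also a lower bound of the
norms of G_(alpha_i) (u_i) for i < k, so every step decreases Psi below the window
maximum by at least delta / alpha_bar mu^2. *)
Lemma grad_map_rate k : (1 <= k)%N ->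
  (\big[mine/+oo]_(i < k.+1) `|G alpha_inf (u i)|%:E <=
    sqrte ((alpha_bar * m_max.+1%:R)%:E * (Psi (u 0%N) - Psi (u k))
                * ((k%:R * delta)^-1)%:E))%E.
Proof.
case: k => // k _; set n := k.+1.
have n0 : 0 < n%:R * delta by rewrite mulr_gt0// ltr0n.
have ab0 := alpha_bar_gt0.
have abm0 : 0 < alpha_bar * m_max.+1%:R by rewrite mulr_gt0// ltr0n.
have Pn : Psi (u n) = (f n)%:E by rewrite objective_fine//; exact: iterate_edom.
(* If the starting point is outside the domain, the right-hand side is +oo. *)
have [du|/(objective_pinfty Fproper) ->] := pselect (edom R (u 0%N)); last first.
  by rewrite Pn addye// gt0_muley ?lte_fin// gt0_mulye ?lte_fin ?invr_gt0// leey.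
have dom j : edom R (u j) by case: j => // j; exact: iterate_edom.
have [i mu_min] : exists i : 'I_n.+1,
    (\big[mine/+oo]_(i < n.+1) `|G alpha_inf (u i)|%:E)%E = `|G alpha_inf (u i)|%:E.
  have [||i _ mu_min] := @eq_bigmin _ _ _ +oo%E (@ord0 n) xpredT
    (fun i : 'I_n.+1 => `|G alpha_inf (u i)|%:E) => //; last by exists i.
  by move=> j _; rewrite leey.
set mu := `|G alpha_inf (u i)| in mu_min.
have mu0 : 0 <= mu by exact: normr_ge0.
have mu_le j : (j < n)%N -> mu <= `|G alpha_inf (u j)|.
  move=> jn; have jn1 : (j < n.+1)%N by exact: ltnW.
  rewrite -lee_fin -mu_min.
  exact: (@bigmin_le _ _ _ +oo%E (Ordinal jn1)
    (fun i : 'I_n.+1 => `|G alpha_inf (u i)|%:E)).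
have rate : n%:R * (delta / alpha_bar * mu ^+ 2) <= m_max.+1%:R * (f 0%N - f n).
  apply: (window_descent_linear (n := n)) => // [|j jn].
    by rewrite mulr_ge0 ?exprn_ge0// divr_ge0// ltW.
  have [//|i' i'm h] := @window_decrease j; exists i' => //.
  apply: le_trans h _; rewrite lerB// ler_pM2l ?divr_gt0// ler_pXn2r ?nnegrE//.
  apply: le_trans (mu_le j jn) _; have /andP[ab _] := step_size_bounds j.
  exact: (grad_map_le _ hilb Rproper Rconvex Rlsc).
rewrite mu_min Pn objective_fine// -EFinB -!EFinM /= lee_fin.
rewrite -[mu]ger0_norm// -sqrtr_sqr ler_wsqrtr//.
rewrite ler_pdivlMr//.
have -> : mu ^+ 2 * (n%:R * delta) = alpha_bar * (n%:R * (delta / alpha_bar * mu ^+ 2)).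
  by field; rewrite gt_eqF.
by rewrite -[leRHS]mulrA ler_pM2l.
Qed.

Lemma weak_accumulation_stationary w :
  weak_to_strong_seq_continuous dot (edom F)° gradF ->
  weak_seq_accumulation_point dot u w -> stationary dot R gradF w.
Proof.
move=> wts [phi phi_incr uw].
have [M uM] := weak_cvg_bounded hilb uw.
have phi_ge n : (n <= phi n)%N.
  by elim: n => // n IH; apply: leq_ltn_trans IH (phi_incr _ _ _).
have phi_gt0 n : (0 < phi n.+1)%N by exact: leq_trans (phi_ge _).
(* The index phi n.+1 is positive, so v n is in the domain of R. *)
pose v n := u (phi n.+1); pose a n := alpha (phi n.+1).
pose v' n := u (phi n.+1).+1; pose g n := G (a n) (v n).
have a0 n : 0 < a n by exact: step_size_gt0.
have vw : weak_cvg dot v w.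
  move=> h; have := uw h.
  rewrite -(cvg_shiftn 1) /=; under eq_fun do rewrite addn1; exact.
have v'E n : v' n = T (a n) (v n) by exact: iterateS.
have g0 : g @ \oo --> (0 : H).
  apply/norm_cvg0P.
  have phi_oo : phi n.+1 @[n --> \oo] --> \oo.
    apply/cvgnyPge => A; exists A => // n /= An.
    exact: leq_trans (leq_trans An _) (phi_ge _).
  exact: (cvg_comp _ _ phi_oo grad_map_cvg0).
have v'w : weak_cvg dot v' w.
  have -> : v' = v \+ (fun n => - ((a n)^-1 *: g n)).
    apply/funext => n; rewrite /= /g /grad_map scalerA mulVf ?gt_eqF// scale1r -v'E /=.
    by rewrite opprB addrC subrK.
  apply: (weak_cvgD hilb vw); apply/norm_cvg0P.
  apply: (@squeeze_cvgr _ _ _ _ (cst 0) (fun n => alpha_inf^-1 * `|g n|)).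
  - near=> n; rewrite normr_ge0/= normrN normrZ ler_wpM2r//.
    rewrite gtr0_norm ?invr_gt0// lef_pV2// ?posrE//.
    by have /andP[] := step_size_bounds (phi n.+1).
  - exact: cvg_cst.
  - rewrite -(mulr0 alpha_inf^-1); apply: cvgMr.
    by rewrite -(@normr0 _ H); exact: cvg_norm.
have sub n : subdifferential dot R (v' n) (g n - gradF (v n)).
  by rewrite v'E; exact: (prox_grad_subgradient _ hilb Rproper Rconvex Rlsc).
have dv n : edom R (v n).
  by rewrite /v -(prednK (phi_gt0 n)); exact: iterate_edom.
have dw : edom R w.
  have /cvg_seq_bounded[B [_ /(_ (B + 1))]] : cvgn g by apply/cvg_ex; exists 0.
  rewrite ltrDl ltr01 => /(_ isT) gB.
  apply: (weak_limit_edom hilb Rproper Rconvex Rlsc v'w sub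
    (B := B + 1 + (L * (M + M) + `|gradF (v 0%N)|))) => n.
  apply: le_trans (ler_normB _ _) _; rewrite lerD//; first exact: gB.
  rewrite -[gradF (v n)](subrK (gradF (v 0%N))).
  apply: le_trans (ler_normD _ _) _; rewrite lerD2r.
  apply: le_trans (lipschitz_le gradL _ _) _; rewrite ler_pM2l//.
  by apply: le_trans (ler_normB _ _) _; rewrite lerD// uM.
apply: (subdifferential_demiclosed hilb Rproper Rconvex Rlsc v'w _ sub).
rewrite -[- gradF w]add0r; apply: cvgB => //.
by apply: wts => //; [move=> n; exact: domRF|exact: domRF].
Unshelve. all: by end_near. Qed.

End Run.

Theorem theorem1 (K : realType) (H : completeNormedModType K)
    (dot : {dot H for idfun}) (F R : H -> \bar K) (gradF : H -> H) (L : K)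
    (delta eta alpha_inf alpha_sup alpha0 : K) (m_max : nat)
    (u0 : H) (u : nat -> H) (alpha : nat -> K) :
  is_hilbert dot ->
  proper_ereal R -> convex_ereal R -> lower_semicontinuous R ->
  (forall v, (-oo < F v)%E) ->
  edom R `<=` (edom F)° ->
  continuously_differentiable_on (edom F)° (fine \o F) ->
  is_gradient dot F gradF ->
  0 < L -> L.-lipschitz gradF ->
  (exists c : K, forall v, (c%:E <= objective F R v)%E) ->
  0 < delta -> delta < 1 -> 1 < eta ->
  0 < alpha_inf -> alpha_inf < alpha_sup -> 0 < alpha0 ->
  nonmonotone_run dot F R gradF delta eta alpha_inf alpha_sup m_max
    u0 alpha0 u alpha ->
  let Psi := objective F R in
  let G := grad_map R gradF in
  let alpha_bar := Num.max (eta * L / (2 * (1 - delta))) alpha_sup in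
  let C_G := (3 * alpha_bar + L) / alpha_inf in
  [/\ (exists2 N, terminates_at R gradF u N & stationary dot R gradF (u N)) \/
      (never_stops R gradF u /\ `|G (alpha k) (u k)| @[k --> \oo] --> (0 : K)),
      never_stops R gradF u -> forall k, (1 <= k)%N ->
        (\big[mine/+oo]_(i < k.+1) `|G alpha_inf (u i)|%:E <=
         (C_G ^+ m_max)%:E *
         sqrte ((alpha_bar * m_max.+1%:R)%:E * (Psi (u 0%N) - Psi (u k))
                * ((k%:R * delta)^-1)%:E))%E &
      never_stops R gradF u ->
      weak_to_strong_seq_continuous dot (edom F)° gradF ->
      forall w, weak_seq_accumulation_point dot u w ->
        stationary dot R gradF w].
Proof.
move=> hilb Rp Rc Rl Fp domRF [Fdiff _] gradFE L0 gradL Pb d0 d1 e1 a0 as0 _.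
move=> [_ run] Psi G alpha_bar C_G.
have run' : never_stops R gradF u -> forall k, algorithm_step dot F R gradF delta eta
    alpha_inf alpha_sup m_max alpha0 u alpha k.
  by move=> ns k; apply: run => j _; exact: ns.
split.
- have [ns|/existsNP[N0 /contrapT stop0]] := pselect (never_stops R gradF u).
    right; split=> //.
    exact: (grad_map_cvg0 hilb Rp Rc Rl L0 gradL Fp domRF Fdiff gradFE Pb
      d0 d1 e1 a0 as0 (run' ns)).
  left.
  have ex : exists n, `[< stop_test R gradF (u n) >] by exists N0; exact/asboolP.
  have [N /asboolP stopN minN] := ex_minnP ex.
  exists N; last exact: (stop_test_stationary hilb Rp Rc Rl stopN).
  split=> // j jN /asboolP /minN; by rewrite leqNgt jN.
- move=> ns k k1.
  apply: le_trans (grad_map_rate hilb Rp Rc Rl L0 gradL Fp domRF Fdiff gradFE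
    d0 d1 e1 a0 as0 (run' ns) k1) _.
  rewrite -/alpha_bar; apply: lee_pemull; first exact: sqrte_ge0.
  rewrite lee_fin exprn_ege1// ler_pdivlMr// mul1r.
  have : alpha_inf < alpha_bar by rewrite lt_max as0 orbT.
  by lra.
- move=> ns wts w.
  exact: (weak_accumulation_stationary hilb Rp Rc Rl L0 gradL Fp domRF Fdiff gradFE
    Pb d0 d1 e1 a0 as0 (run' ns) wts).
Qed.
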